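(* For every 3-hypergraph $\mathbb{H}$, the 3-hypergraph semigroup $SG_{\mathbb{H}}$ is 0-cancellative, i.e. for all $x,y,z\in SG_{\mathbb{H}}$: $xy=xz\neq 0$ implies $y=z$, and $yx=zx\neq0$ implies $y=z$.
   Context: A hypergraph $\mathbb{H}=(V,E)$ consists of a finite set $V$ of vertices and a set $E$ of subsets of $V$ (hyperedges). A 3-hypergraph is a hypergraph whose largest hyperedge has exactly 3 elements and which satisfies the following standing assumptions: it is finite; it is linear (any two distinct hyperedges share at most one vertex); every vertex lies in some hyperedge; every hyperedge has at least 2 elements; and every hyperedge with exactly 2 elements is disjoint from all other hyperedges. A subhyperedge is a nonempty subset of a hyperedge. Two subhyperedges $e_1',e_2'$ are linked if there is a single vertex $w\notin e_1'\cup e_2'$ such that $e_1'\cup\{w\}$ and $e_2'\cup\{w\}$ are both hyperedges. The 3-hypergraph semigroup $SG_{\mathbb{H}}\cong X^+/R^{\#}$ is the semigroup given by the presentation with generating set $X=\{\mathbf{a}_u\mid u\in V\}\cup\{0\}$ and set of relations $R$ consisting of: $\mathbf{a}_u\mathbf{a}_v=\mathbf{a}_v\mathbf{a}_u$; $0\mathbf{a}_u=\mathbf{a}_u0=00=0$; $\mathbf{a}_u\mathbf{a}_v=0$ if $u=v$ or $\{u,v\}$ is not a subhyperedge; $\mathbf{a}_u\mathbf{a}_v\mathbf{a}_h=0$ if $\{u,v,h\}\notin E$; $\mathbf{a}_{u_i}\mathbf{a}_{u_j}=\mathbf{a}_{u_r}\mathbf{a}_{u_l}$ if $\{u_i,u_j\}$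 and $\{u_r,u_l\}$ are linked; and for every hyperedge $\{u_1,\dots,u_k\}$ (of $k$ elements), $\mathbf{a}_{u_1}\cdots\mathbf{a}_{u_k}=\mathbf{a}$, where $\mathbf{a}$ is one and the same (nonzero) element for all hyperedges. Here $R^{\#}$ is the congruence on the free semigroup $X^+$ generated by $R$. *)

(* Defs.v *)
From HB Require Import structures.
From mathcomp Require Import all_boot.
From mathcomp Require Import boolp.
Set Implicit Arguments.
Unset Strict Implicit.
Unset Printing Implicit Defensive.
Set Warnings "-redundant-canonical-projection".

Local Open Scope group_scope.
Local Open Scope quotient_scope.

(* As hyperedges have at least 2 elements, the largest one has exactly 3 iff
   all have at most 3 and some has 3. *)
Definition three_hypergraph (V : finType) (E : {set {set V}}) : Prop :=
  [/\ (forall e, e \in E -> 2 <= #|e| <= 3) /\ (exists2 e, e \in E & #|e| = 3),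
      forall e f, e \in E -> f \in E -> e != f -> #|e :&: f| <= 1,
      forall v : V, exists2 e, e \in E & v \in e
    & forall e f, e \in E -> f \in E -> e != f -> #|e| = 2 -> [disjoint e & f]].

Definition subhyperedge (V : finType) (E : {set {set V}}) (e : {set V}) : bool :=
  (e != set0) && [exists f in E, e \subset f].

Definition linked (V : finType) (E : {set {set V}}) (e1 e2 : {set V}) : bool :=
  [&& subhyperedge E e1, subhyperedge E e2 &
      [exists w, [&& w \notin e1 :|: e2, w |: e1 \in E & w |: e2 \in E]]].

Definition free_semigroup (X : Type) : Type := {w : seq X | ~~ nilp w}.

HB.instance Definition _ (X : choiceType) :=
  Choice.copy (free_semigroup X) {w : seq X | ~~ nilp w}.

Definition word (X : Type) (x : X) (s : seq X) : free_semigroup X :=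
  exist _ (x :: s) isT.

Definition letter (X : Type) (x : X) : free_semigroup X := word x [::].

Lemma cat_nonempty (X : Type) (v w : free_semigroup X) :
  ~~ nilp (sval v ++ sval w).
Proof. by case: v => -[]. Qed.

Definition free_mul (X : Type) (v w : free_semigroup X) : free_semigroup X :=
  exist _ (sval v ++ sval w) (cat_nonempty v w).

Lemma free_mulA (X : choiceType) : associative (@free_mul X).
Proof. by move=> u v w; apply: val_inj; rewrite /= catA. Qed.

HB.instance Definition _ (X : choiceType) :=
  isSemigroup.Build (free_semigroup X) (@free_mulA X).

Inductive congruence_closure (S : semigroupType) (R : S -> S -> Prop) :
    S -> S -> Prop :=
| cc_incl x y : R x y -> congruence_closure R x y
| cc_refl x : congruence_closure R x x
| cc_sym x y : congruence_closure R x y -> congruence_closure R y x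
| cc_trans y x z :
    congruence_closure R x y -> congruence_closure R y z ->
    congruence_closure R x z
| cc_mul x x' y y' :
    congruence_closure R x x' -> congruence_closure R y y' ->
    congruence_closure R (x * y) (x' * y').

Definition congruenceb (S : semigroupType) (R : S -> S -> Prop) : rel S :=
  fun x y => `[< congruence_closure R x y >].

Lemma congruenceb_refl (S : semigroupType) (R : S -> S -> Prop) :
  reflexive (congruenceb R).
Proof. by move=> x; apply/asboolP; apply: cc_refl. Qed.

Lemma congruenceb_sym (S : semigroupType) (R : S -> S -> Prop) :
  symmetric (congruenceb R).
Proof. by move=> x y; apply/asboolP/asboolP; apply: cc_sym. Qed.

Lemma congruenceb_trans (S : semigroupType) (R : S -> S -> Prop) :
  transitive (congruenceb R).
Proof.
by move=> y x z /asboolP xy /asboolP yz; apply/asboolP; apply: cc_trans xy yz.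
Qed.

Canonical congruence_equiv (S : semigroupType) (R : S -> S -> Prop) :=
  EquivRel (congruenceb R) (congruenceb_refl R) (congruenceb_sym R)
    (@congruenceb_trans S R).

Definition quotient_semigroup (S : semigroupType) (R : S -> S -> Prop) : Type :=
  {eq_quot congruence_equiv R}.

HB.instance Definition _ (S : semigroupType) (R : S -> S -> Prop) :=
  Choice.on (quotient_semigroup R).

HB.instance Definition _ (S : semigroupType) (R : S -> S -> Prop) :=
  EqQuotient.on (quotient_semigroup R).

Lemma quotient_eqP (S : semigroupType) (R : S -> S -> Prop) (x y : S) :
  \pi_(quotient_semigroup R) x = \pi_(quotient_semigroup R) y <->
  congruence_closure R x y.
Proof.
by split=> [/eqP|h]; [rewrite eqmodE => /asboolP | apply/eqmodP/asboolP].
Qed.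

Definition quotient_mul (S : semigroupType) (R : S -> S -> Prop)
    (x y : quotient_semigroup R) : quotient_semigroup R :=
  \pi_(quotient_semigroup R) (repr x * repr y).

Lemma quotient_mulE (S : semigroupType) (R : S -> S -> Prop) (x y : S) :
  quotient_mul (\pi_(quotient_semigroup R) x) (\pi_(quotient_semigroup R) y) =
  \pi_(quotient_semigroup R) (x * y).
Proof. by apply/quotient_eqP/cc_mul; apply/quotient_eqP; rewrite reprK. Qed.

Lemma quotient_mulA (S : semigroupType) (R : S -> S -> Prop) :
  associative (@quotient_mul S R).
Proof.
move=> x y z; rewrite -[x]reprK -[y]reprK -[z]reprK.
by rewrite !quotient_mulE !reprK mulgA.
Qed.

HB.instance Definition _ (S : semigroupType) (R : S -> S -> Prop) :=
  isSemigroup.Build (quotient_semigroup R) (@quotient_mulA S R).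

(* The generator a_u is [Some u] and the generator 0 is [None]. *)
Definition gen (V : finType) (u : V) : free_semigroup (option V) :=
  letter (Some u).

Definition gen0 (V : finType) : free_semigroup (option V) := letter None.

Arguments gen0 {V}.

Inductive hypergraph_rel (V : finType) (E : {set {set V}}) :
    free_semigroup (option V) -> free_semigroup (option V) -> Prop :=
| rel_comm u v : hypergraph_rel E (gen u * gen v) (gen v * gen u)
| rel_0l u : hypergraph_rel E (gen0 * gen u) gen0
| rel_0r u : hypergraph_rel E (gen u * gen0) gen0
| rel_00 : hypergraph_rel E (gen0 * gen0) gen0
| rel_pair u v :
    u = v \/ ~~ subhyperedge E [set u; v] ->
    hypergraph_rel E (gen u * gen v) gen0
| rel_triple u v h :
    [set u; v; h] \notin E -> hypergraph_rel E (gen u * gen v * gen h) gen0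
| rel_linked i j r l :
    linked E [set i; j] [set r; l] ->
    hypergraph_rel E (gen i * gen j) (gen r * gen l)
(* The common value a is not a generator: equating the products of any two
   listings of hyperedges without repetition says that they all have one and
   the same value. *)
| rel_hyperedge u s v t :
    uniq (u :: s) -> uniq (v :: t) ->
    [set:: u :: s] \in E -> [set:: v :: t] \in E ->
    hypergraph_rel E (word (Some u) (map Some s)) (word (Some v) (map Some t)).

Definition hypergraph_semigroup (V : finType) (E : {set {set V}}) :
    semigroupType :=
  quotient_semigroup (@hypergraph_rel V E).

Definition hypergraph_zero (V : finType) (E : {set {set V}}) :
    hypergraph_semigroup E :=
  \pi_(quotient_semigroup (@hypergraph_rel V E)) gen0.

Definition zero_cancellative (S : semigroupType) (o : S) : Prop :=
  forall x y z : S,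
    (x * y = x * z -> x * z <> o -> y = z) /\
    (y * x = z * x -> z * x <> o -> y = z).

(* Main.v *)
Require Import Defs.
From mathcomp Require Import all_boot.

(** Call a word a listing if it lists the vertices of a hyperedge without
    repetition. The semigroup turns out to be the syntactic semigroup of the
    set of listings. On the one hand the set of right complements of a word,
    i.e. of the t such that x t is a listing, only depends on the class of x,
    and it is nonempty if x is nonzero. On the other hand two words with a
    common nonempty complement are congruent: by linearity they are either the
    same generator or products of linked pairs. If x y = x z is nonzero with
    complement t, then y and z have the common complement x t. *)

Set Implicit Arguments.
Unset Strict Implicit.
Unset Printing Implicit Defensive.

Local Open Scope group_scope.
Local Open Scope quotient_scope.

(** * Listings of hyperedges *)

Section ThreeHypergraph.
Variables (V : finType) (E : {set {set V}}).

(** Plain sequences are used instead of [free_semigroup] because a complement may be empty, as it is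
    for a word that already lists a hyperedge. *)
Definition edge_listing (s : seq (option V)) : bool :=
  [&& uniq s, None \notin s & [set u | Some u \in s] \in E].

Lemma edge_listing_perm s t :
  perm_eq s t -> edge_listing s = edge_listing t.
Proof.
move=> st; rewrite /edge_listing (perm_uniq st) (perm_mem st).
by congr [&& _, _ & _ \in E]; apply/setP=> u; rewrite !inE (perm_mem st).
Qed.

Lemma edge_listing_map (s : seq V) :
  edge_listing (map Some s) = uniq s && ([set:: s] \in E).
Proof.
rewrite /edge_listing map_inj_uniq; last exact: Some_inj.
have -> : None \notin map Some s by apply/mapP=> -[].
congr (_ && (_ \in E)); apply/setP=> u.
by rewrite !inE mem_map //; exact: Some_inj.
Qed.

Lemma notNone_map (s : seq (option V)) :
  None \notin s -> exists s', s = map Some s'.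
Proof.
elim: s => [|[u|] s IHs] //=; first by exists [::].
by rewrite inE /= => /IHs[s' ->]; exists (u :: s').
Qed.

Lemma edge_listing_catP (x t : seq (option V)) :
  edge_listing (x ++ t) ->
  exists x' t', [/\ x = map Some x', t = map Some t',
                    uniq (x' ++ t') & [set:: x' ++ t'] \in E].
Proof.
move=> xt; have := xt; rewrite /edge_listing => /and3P[_ + _].
rewrite mem_cat negb_or => /andP[/notNone_map[x' ex] /notNone_map[t' et]].
exists x', t'; move: xt; rewrite ex et -map_cat edge_listing_map.
by move=> /andP[].
Qed.

(** * Sizes and intersections of hyperedges *)

Hypothesis hE : three_hypergraph E.

Lemma card_edge e : e \in E -> 2 <= #|e| <= 3.
Proof. by case: hE => -[+ _] _ _ _; apply. Qed.

Lemma linear_edges u v e f :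
  e \in E -> f \in E -> u != v -> u \in e -> v \in e -> u \in f -> v \in f ->
  e = f.
Proof.
case: hE => _ lin _ _ eE fE uv ue ve uf vf; apply/eqP/contraT => ef.
have := lin _ _ eE fE ef; rewrite leqNgt => /negP[].
have -> : 2 = #|[set u; v]| by rewrite cards2 uv.
by apply/subset_leq_card/subsetP => x; rewrite !inE => /orP[]/eqP->; apply/andP.
Qed.

Lemma edge2_isolated u e f :
  e \in E -> f \in E -> #|e| = 2 -> u \in e -> u \in f -> e = f.
Proof.
case: hE => _ _ _ dis eE fE e2 ue uf; apply/eqP/contraT => ef.
by have /disjoint_setI0/setP/(_ u) := dis _ _ eE fE ef e2; rewrite !inE ue uf.
Qed.

Lemma card_set_uniq (s : seq V) : uniq s -> #|[set:: s]| = size s.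
Proof. by move/card_uniqP => <-; rewrite cardsE. Qed.

Lemma size_edge (s : seq V) :
  uniq s -> [set:: s] \in E -> 2 <= size s <= 3.
Proof. by move=> us sE; rewrite -card_set_uniq // card_edge. Qed.

Lemma linked_sym e f : linked E e f = linked E f e.
Proof.
rewrite /linked andbCA; congr [&& _, _ & _].
by apply: eq_existsb => w; rewrite setUC [X in _ && X]andbC.
Qed.

(** * Invariance of complements under the congruence *)

(** Let [w] be the linking vertex. The hyperedge listed by [i], [j], [t] shares [i] and [j] with the
    one formed by [w], [i], [j], so by linearity they coincide and [t] is just [w], which also
    completes [r], [l]. *)
Lemma edge_listing_linked i j r l t :
  linked E [set i; j] [set r; l] ->
  edge_listing ([:: Some i; Some j] ++ t) ->
  edge_listing ([:: Some r; Some l] ++ t).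
Proof.
case/and3P=> _ _ /existsP[w /and3P[]].
rewrite !inE => /norP[/norP[wi wj] /norP[wr wl]] eE fE.
rewrite -[[:: Some i; Some j]]/(map Some [:: i; j]).
case/edge_listing_catP=> _ [t' [/(inj_map Some_inj) <- -> uit itE]].
have ij : i != j by case/andP: uit; rewrite inE negb_or => /andP[].
(* If [r = l], the hyperedge formed by [w] and [r] has two elements and meets the three-element one
   formed by [w], [i], [j], against isolation. *)
have rl : r != l.
  apply/eqP=> erl; subst l.
  have f2 : #|w |: [set r; r]| = 2 by rewrite setUid cards2 wr.
  have /(congr1 (fun A : {set V} => #|A|)) :
      w |: [set r; r] = w |: [set i; j].
    by apply: (@edge2_isolated w); rewrite // !inE eqxx.
  by rewrite f2 cardsU1 cards2 !inE negb_or wi wj ij.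
have te : [set:: [:: i; j] ++ t'] = w |: [set i; j].
  by apply: (@linear_edges i j); rewrite // !inE eqxx ?orbT.
have : size t' = 1%N.
  have := card_set_uniq uit; rewrite te cardsU1 cards2 !inE negb_or wi wj ij.
  by rewrite size_cat => -[].
case: t' te uit itE => [|k [|]] // te uit _ _.
have wk : k = w.
  move/setP/(_ w): te; rewrite !inE eqxx (negPf wi) (negPf wj) /=.
  by move=> /eqP->.
rewrite wk -[_ ++ _]/(map Some [:: r; l; w]) edge_listing_map.
rewrite /= !inE negb_or rl eq_sym wr eq_sym wl /=.
suff -> : [set:: [:: r; l; w]] = w |: [set r; l] by [].
by apply/setP=> u; rewrite !inE orbA orbC.
Qed.

(** A hyperedge has at least two vertices, so by linearity no other hyperedge contains it: nothing
    can be appended to a listing. *)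
Lemma edge_listing_edge (s : seq V) t :
  uniq s -> [set:: s] \in E -> edge_listing (map Some s ++ t) = nilp t.
Proof.
move=> us sE; apply/idP/nilP=> [|->]; last by rewrite cats0 edge_listing_map us.
case/edge_listing_catP=> s' [t' [/(inj_map Some_inj) <- -> ust stE]].
have : size s = size (s ++ t').
  rewrite -!card_set_uniq //; congr #|pred_of_set _|.
  case: s us sE ust stE => [|u [|v s]] us sE ust stE;
    try by have := size_edge us sE.
  apply: (@linear_edges u v) => //; rewrite ?inE ?eqxx ?orbT //.
  by case/andP: us; rewrite inE negb_or => /andP[].
by rewrite size_cat; case: t' {ust stE} => //= k t' /eqP;
  rewrite -{1}[size s]addn0 eqn_add2l.
Qed.

Lemma edge_listing_None s : None \in s -> edge_listing s = false.
Proof. by rewrite /edge_listing => ->; rewrite andbF. Qed.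

(** Both sides of a relation with value 0 have no complement at all, and both sides of
    [rel_hyperedge] have only the empty one. *)
Lemma edge_listing_rel x y t : hypergraph_rel E x y ->
  edge_listing (sval x ++ t) = edge_listing (sval y ++ t).
Proof.
case=> {x y} [u v|u|u||u v uv|u v h uvh|i j r l ijrl|u s v t' us vt usE vtE] /=.
- by apply: edge_listing_perm; rewrite (perm_catCA [:: _] [:: _] t).
- by rewrite !edge_listing_None // !inE.
- by rewrite !edge_listing_None // !inE.
- by rewrite !edge_listing_None // !inE.
(* A complement of [u], [v] would make them distinct vertices of one hyperedge. *)
- rewrite [RHS]edge_listing_None ?inE //; apply/negP.
  rewrite -[_ :: _]/(map Some [:: u; v] ++ t).
  case/edge_listing_catP=> _ [t' [/(inj_map Some_inj) <- _ ut tE]].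
  case: uv => [euv|/negP[]]; first by move: ut; rewrite euv /= inE eqxx.
  apply/andP; split; first by apply/set0Pn; exists u; rewrite !inE eqxx.
  apply/existsP; exists [set:: [:: u; v] ++ t']; rewrite tE /=.
  by apply/subsetP=> x; rewrite !inE => /orP[]->; rewrite ?orbT.
(* Three distinct letters exhaust a hyperedge, so a complement would be empty. *)
- rewrite [RHS]edge_listing_None ?inE //; apply/negP.
  rewrite -[_ :: _]/(map Some [:: u; v; h] ++ t).
  case/edge_listing_catP=> _ [t' [/(inj_map Some_inj) <- _ ut tE]].
  case: t' ut tE => [|k t'] ut tE; last by have := size_edge ut tE.
  move/negP: uvh; apply; rewrite cats0 in tE.
  suff -> : [set u; v; h] = [set:: [:: u; v; h]] by [].
  by apply/setP=> x; rewrite !inE orbA.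
- by apply/idP/idP; apply: edge_listing_linked; rewrite // linked_sym.
- by rewrite (edge_listing_edge t us usE) (edge_listing_edge t vt vtE).
Qed.

Local Notation "x ≡ y" := (congruence_closure (@hypergraph_rel V E) x y)
  (at level 70).

Lemma edge_listing_congr x y : x ≡ y ->
  forall t, edge_listing (sval x ++ t) = edge_listing (sval y ++ t).
Proof.
elim=> {x y} [x y xy|x|x y _ IH|y x z _ IH1 _ IH2|x x' y y' _ IH1 _ IH2] t //.
- exact: edge_listing_rel.
- by rewrite IH1 IH2.
(* Replace the first factor, with the second one absorbed into the complement; then swap the factors
   and do the same for the second. *)
- rewrite /= -!catA IH1 (edge_listing_perm (permEl (perm_catCA _ _ _))) IH2.
  exact: edge_listing_perm (permEl (perm_catCA _ _ _)).
Qed.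

(** * Words congruent to zero *)

Lemma letter_mul0 o : letter o * gen0 ≡ gen0.
Proof. by case: o => [u|]; apply: cc_incl; constructor. Qed.

Lemma mul0_letter o : gen0 * letter o ≡ gen0.
Proof. by case: o => [u|]; apply: cc_incl; constructor. Qed.

Lemma word_cons (X : choiceType) (o p : X) s :
  word o (p :: s) = letter o * word p s.
Proof. exact: val_inj. Qed.

Lemma word_rcons (X : choiceType) (o p : X) s :
  word o (rcons s p) = word o s * letter p.
Proof. by apply: val_inj; rewrite /= cats1. Qed.

Lemma word_cons0 o p s : word p s ≡ gen0 -> word o (p :: s) ≡ gen0.
Proof.
rewrite word_cons => h; apply: cc_trans (letter_mul0 o).
by apply: cc_mul h; apply: cc_refl.
Qed.

Lemma word_cat0 o s t : word o s ≡ gen0 -> word o (s ++ t) ≡ gen0.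
Proof.
move=> h; elim/last_ind: t => [|t p IHt]; first by rewrite cats0.
rewrite -rcons_cat word_rcons; apply: cc_trans (mul0_letter p).
by apply: cc_mul IHt _; apply: cc_refl.
Qed.

Lemma word_None0 o s : None \in o :: s -> word o s ≡ gen0.
Proof.
case: o => [u|] h; last by apply: (@word_cat0 None [::]); apply: cc_refl.
elim: s u h => [|[v|] s IHs] u //=; rewrite inE /= => h; apply: word_cons0.
  exact: IHs.
by apply: (@word_cat0 None [::]); apply: cc_refl.
Qed.

(** Commute the leading [u] to the right until it meets its other occurrence; the square of a
    generator is 0. *)
Lemma word_repeat0 (u : V) s :
  u \in s -> word (Some u) (map Some s) ≡ gen0.
Proof.
elim: s => [|v s IHs] //; rewrite inE; have [-> _ | uv /= us] := eqVneq u v.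
  apply: (@word_cat0 _ [:: Some v]); apply: cc_incl.
  by rewrite word_cons; apply: rel_pair; left.
apply: (@cc_trans _ _ (word (Some v) (Some u :: map Some s))).
  case: s us {IHs} => // w s _; rewrite !word_cons !mulgA.
  by apply: cc_mul; [apply/cc_incl/rel_comm | apply: cc_refl].
by apply: word_cons0; apply: IHs.
Qed.

Lemma word_nonuniq0 (u : V) s :
  ~~ uniq (u :: s) -> word (Some u) (map Some s) ≡ gen0.
Proof.
elim: s u => [|v s IHs] u //; rewrite [uniq _]/= negb_and negbK.
by case/orP=> [/word_repeat0 // | /IHs]; apply: word_cons0.
Qed.

Lemma triple0 u v h :
  [set:: [:: u; v; h]] \notin E -> word (Some u) [:: Some v; Some h] ≡ gen0.
Proof.
move=> uvh; rewrite !word_cons mulgA; apply/cc_incl/rel_triple.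
suff -> : [set u; v; h] = [set:: [:: u; v; h]] by [].
by apply/setP=> x; rewrite !inE orbA.
Qed.

(** * Complements of nonzero words *)

Lemma edge_listing_cat_setD (s : seq V) e :
  e \in E -> uniq s -> {subset s <= e} ->
  edge_listing (map Some (s ++ enum (e :\: [set:: s]))).
Proof.
move=> eE us se; rewrite edge_listing_map cat_uniq us enum_uniq andbT /=.
apply/andP; split.
  by apply/hasPn=> x; rewrite mem_enum !inE => /andP[].
suff -> : [set:: s ++ enum (e :\: [set:: s])] = e by [].
apply/setP=> x; rewrite !inE mem_cat mem_enum !inE.
by case: (boolP (x \in s)) => // /se ->.
Qed.

(** A nonzero word has no letter 0 and no repetition. One letter lies in some hyperedge; two or
    three letters do so because otherwise [rel_pair] or [rel_triple] would give 0; four or more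
    letters always give 0. *)
Lemma nonzero_complement (x : free_semigroup (option V)) :
  ~ x ≡ gen0 -> exists t, edge_listing (sval x ++ t).
Proof.
case: x => -[|o s] // ne; have -> : ne = isT by exact: bool_irrelevance.
rewrite -/(word o s) {ne} => x0; have [/word_None0 //|] := boolP (None \in o :: s).
case/notNone_map=> -[|u s'] //= [eo es]; subst o s.
have [us|/word_nonuniq0 //] := boolP (uniq (u :: s')).
(* It is enough to find a hyperedge containing all letters: its remaining vertices form the
   complement. *)
have sub_complement e : e \in E -> {subset u :: s' <= e} ->
    exists t, edge_listing (map Some (u :: s') ++ t).
  move=> eE se; exists (map Some (enum (e :\: [set:: u :: s']))).
  by rewrite -map_cat; apply: edge_listing_cat_setD.
case: s' us x0 sub_complement => [|v [|h [|k s]]] us x0 sub_complement.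
- case: hE => _ _ /(_ u)[e eE ue] _; apply: (sub_complement e) => // x.
  by rewrite inE => /eqP->.
- have [/andP[_ /existsP[e /andP[eE /subsetP se]]]|nuv] :=
    boolP (subhyperedge E [set u; v]).
    by apply: (sub_complement e) => // x; have := se x; rewrite !inE.
  by case: x0; rewrite /= word_cons; apply/cc_incl/rel_pair; right.
- have [uvhE|/triple0 //] := boolP ([set:: [:: u; v; h]] \in E).
  by apply: (sub_complement [set:: [:: u; v; h]]) => // x; rewrite !inE.
(* With four letters or more, both [u v h] and [v h k] would list hyperedges. These share [v] and
   [h], so they are equal by linearity, which puts [u] among [v], [h], [k]. *)
- have [uvhE|/triple0/(@word_cat0 _ _ (map Some (k :: s))) //] :=
    boolP ([set:: [:: u; v; h]] \in E).
  have [vhkE|/triple0/(@word_cat0 _ _ (map Some s)) vhk0] :=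
    boolP ([set:: [:: v; h; k]] \in E); last first.
    by case: x0; apply: word_cons0.
  have vh : v != h by case/and3P: us => _; rewrite inE negb_or => /andP[].
  have /setP/(_ u) : [set:: [:: u; v; h]] = [set:: [:: v; h; k]].
    by apply: (@linear_edges v h); rewrite // !inE eqxx ?orbT.
  rewrite !inE eqxx /=; case/andP: us; rewrite !inE !negb_or.
  by case/and4P=> /negPf-> /negPf-> /negPf->.
Qed.

(** * Words with a common complement *)

Lemma linkedI w i j r l :
  uniq [:: w; i; j] -> uniq [:: w; r; l] ->
  [set:: [:: w; i; j]] \in E -> [set:: [:: w; r; l]] \in E ->
  linked E [set i; j] [set r; l].
Proof.
have eqE a b : [set:: [:: w; a; b]] = w |: [set a; b].
  by apply/setP=> x; rewrite !inE.
have sub a b : w |: [set a; b] \in E -> subhyperedge E [set a; b].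
  move=> abE; apply/andP; split; first by apply/set0Pn; exists a; rewrite !inE eqxx.
  by apply/existsP; exists (w |: [set a; b]); rewrite abE subsetUr.
rewrite !eqE /= !inE => /and3P[wij _ _] /and3P[wrl _ _] eE fE.
apply/and3P; split; [exact: sub | exact: sub |].
by apply/existsP; exists w; rewrite eE fE !inE negb_or wij wrl.
Qed.

(** If [s] has at least two letters, linearity makes the two hyperedges equal, and [y] and [z] are
    the one vertex left. If [s] is a single [w], either the hyperedges are equal of size two, or
    both have size three and [y], [z] are pairs linked through [w]. *)
Lemma common_complement (y z : free_semigroup (option V)) s :
  ~~ nilp s -> edge_listing (s ++ sval y) -> edge_listing (s ++ sval z) ->
  y ≡ z.
Proof.
case: y => y hy; case: z => z hz /= hs.
case/edge_listing_catP=> s1 [y' [es ey uy yE]].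
case/edge_listing_catP=> s2 [z' [es' ez uz zE]].
have ess : s1 = s2 by apply: (inj_map Some_inj); rewrite -es -es'.
subst s2 s y z; rewrite /nilp !size_map in hs; clear es'.
have uniqueP p q : y' = [:: p] -> z' = [:: q] ->
    [set:: s1 ++ y'] = [set:: s1 ++ z'] -> p = q.
  move=> ey ez /setP/(_ p); subst y' z'; rewrite !inE !mem_cat !inE eqxx orbT.
  move/esym; case/orP=> [ps|/eqP//].
  by move: uy; rewrite cats1 rcons_uniq ps.
have letterP p q : y' = [:: p] -> z' = [:: q] ->
    [set:: s1 ++ y'] = [set:: s1 ++ z'] ->
    (exist _ (map Some y') hy : free_semigroup (option V)) ≡
    exist _ (map Some z') hz.
  move=> ey ez /(uniqueP _ _ ey ez) epq; subst q y' z'.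
  have -> : hy = hz by exact: bool_irrelevance.
  exact: cc_refl.
have sy := size_edge uy yE; have sz := size_edge uz zE.
case: s1 hs uy uz yE zE sy sz {uniqueP} letterP => [|w [|w' s]] // _ uy uz yE zE.
(* Both hyperedges contain [w], so isolation identifies them as soon as one has two elements; this
   also excludes sizes two and three together. *)
- have same2 : #|[set:: [:: w] ++ y']| = 2 \/ #|[set:: [:: w] ++ z']| = 2 ->
      [set:: [:: w] ++ y'] = [set:: [:: w] ++ z'].
    case=> h2; [|apply/esym];
      by apply: (@edge2_isolated w); rewrite // !inE eqxx.
  rewrite (card_set_uniq uy) (card_set_uniq uz) in same2.
  have same_size : [set:: [:: w] ++ y'] = [set:: [:: w] ++ z'] -> size y' = size z'.
    move/(congr1 (fun A : {set V} => #|A|)).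
    by rewrite (card_set_uniq uy) (card_set_uniq uz) => -[].
  case: y' z' hy hz uy uz yE zE same2 same_size => [|i [|j [|? ?]]]
    [|r [|l [|? ?]]] //= hy hz uy uz yE zE same2 same_size _ _ letterP.
  + by apply: letterP => //; apply: same2; left.
  + by have /same_size := same2 (or_introl erefl).
  + by have /same_size := same2 (or_intror erefl).
  + have -> : exist _ [:: Some i; Some j] hy = gen i * gen j by exact: val_inj.
    have -> : exist _ [:: Some r; Some l] hz = gen r * gen l by exact: val_inj.
    by apply/cc_incl/rel_linked/linkedI; eassumption.
- have ww' : w != w' by case/andP: uy; rewrite inE negb_or => /andP[].
  have eyz : [set:: [:: w, w' & s] ++ y'] = [set:: [:: w, w' & s] ++ z'].
    by apply: (@linear_edges w w'); rewrite // !inE eqxx ?orbT.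
  (* Beyond [w] and [w'] a hyperedge has at most one vertex, and [y'], [z'] are nonempty, so each is
     a single letter. *)
  rewrite !size_cat /= !addSn !ltnS => sy sz letterP.
  case: y' z' hy hz {uy uz yE zE} sy sz eyz letterP
    => [|p [|p' y']] [|q [|q' z']] // hy hz sy sz eyz letterP;
    try by move: sy; rewrite /= !addnS.
  + exact: letterP eyz.
  + by move: sz; rewrite /= !addnS.
Qed.

End ThreeHypergraph.

Theorem proposition2p3 (V : finType) (E : {set {set V}})
    (hE : three_hypergraph E) :
  zero_cancellative (hypergraph_zero E).
Proof.
move=> x y z; rewrite -[x]reprK -[y]reprK -[z]reprK.
move: (repr x) (repr y) (repr z) => {}x {}y {}z.
rewrite -![_ * _]/(quotient_mul _ _) !quotient_mulE.
split=> /quotient_eqP xyz nz; apply/quotient_eqP.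
- have [t xzt] := nonzero_complement hE (fun h => nz ((quotient_eqP _ _ _).2 h)).
  have xyt := xzt; rewrite -(edge_listing_congr hE xyz) in xyt.
  (* As [x y] and [x z] are congruent, [t] completes both; moving [x] next to [t] gives [y] and [z]
     the nonempty common complement [x t]. *)
  apply: (common_complement (s := sval x ++ t) hE).
  + by case: x {xyz nz xzt xyt} => -[].
  + by rewrite (edge_listing_perm _ (permEl (perm_catAC _ _ _))).
  + by rewrite (edge_listing_perm _ (permEl (perm_catAC _ _ _))).
- have [t zxt] := nonzero_complement hE (fun h => nz ((quotient_eqP _ _ _).2 h)).
  have yxt := zxt; rewrite -(edge_listing_congr hE xyz) in yxt.
  (* Here [x] already stands next to [t], and only the block [x t] has to be moved to the front. *)
  apply: (common_complement (s := sval x ++ t) hE).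
  + by case: x {xyz nz zxt yxt} => -[].
  + by rewrite (edge_listing_perm _ (permEl (perm_catC _ _))) catA.
  + by rewrite (edge_listing_perm _ (permEl (perm_catC _ _))) catA.
Qed.
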